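(* For $n\ge 0$, let $w_n$ be the total number of pairs $(T,P)$, where $T$ is a tiling of the $(2\times n)$-board by $(1\times 1)$-squares and dominoes, and $P$ is a shortest lattice walk crossing the tiled board in the sense described in the context. Then for all $n\ge 9$, $$w_n=8w_{n-1}-17w_{n-2}-7w_{n-3}+41w_{n-4}+w_{n-5}-23w_{n-6}+3w_{n-7}+4w_{n-8}-w_{n-9},$$ with initial values $w_0,\dots,w_8$ equal to $1, 5, 28, 130, 569, 2352, 9363, 36183, 136663$. Equivalently, define $y_n=w_n+w_{n-1}$, $x_n=y_n-3y_{n-1}+y_{n-2}$, and $r_n=x_n-3x_{n-1}-x_{n-2}+x_{n-3}$. Then $r_n=3r_{n-1}+r_{n-2}-r_{n-3}$ holds for every $n$ for which all terms involved are defined, i.e. all indices of $w$ are nonnegative.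
   Context: The $(2\times n)$-board is the rectangle $[0,n]\times[0,2]$ subdivided into $2n$ unit cells; its grid segments are the unit edges of these cells. A tiling covers the board with non-overlapping unit squares and dominoes. A domino is the union of two cells sharing an edge and may be placed horizontally or vertically. Given a tiling, a walk crossing the board is a path along grid segments from the lower-left corner $(0,0)$ to the upper-right corner $(n,2)$ of shortest possible length, i.e. of length $n+2$, consisting of unit right and up steps. The walk may not use any grid segment lying in the interior of a domino, i.e. the segment separating the two cells of a domino. For $n=0$ the board is the segment from $(0,0)$ to $(0,2)$, there is one empty tiling, and exactly one walk. *)

(* Defs.v *)
From HB Require Import structures.
From mathcomp Require Import all_boot all_order all_algebra.
Set Implicit Arguments.
Unset Strict Implicit.
Unset Printing Implicit Defensive.

Import GRing.Theory.
Local Open Scope nat_scope.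

(* The cell (i, j) is the unit square [i, i+1] x [j, j+1]. *)
Definition cell (n : nat) : finType := ('I_n * 'I_2)%type.

Definition vertex (n : nat) : finType := ('I_n.+1 * 'I_3)%type.

Definition corner n (c : cell n) (u : vertex n) : bool :=
  ((u.1 == c.1 :> nat) || (u.1 == c.1.+1 :> nat)) &&
  ((u.2 == c.2 :> nat) || (u.2 == c.2.+1 :> nat)).

Definition right_step n (u v : vertex n) : bool :=
  (v.1 == u.1.+1 :> nat) && (v.2 == u.2 :> nat).

Definition up_step n (u v : vertex n) : bool :=
  (v.1 == u.1 :> nat) && (v.2 == u.2.+1 :> nat).

(* The grid segments of the board are the pairs (u, v) with [unit_step u v],
   each oriented rightwards or upwards. *)
Definition unit_step n (u v : vertex n) : bool :=
  right_step u v || up_step u v.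

Definition cell_edge n (c : cell n) (u v : vertex n) : bool :=
  [&& unit_step u v, corner c u & corner c v].

Definition is_square n (B : {set cell n}) : bool :=
  [exists c : cell n, B == [set c]].

Definition is_domino n (B : {set cell n}) : bool :=
  [exists c : cell n, exists d : cell n,
    [&& B == [set c; d], c != d &
      [exists u : vertex n, exists v : vertex n,
        cell_edge c u v && cell_edge d u v]]].

Definition is_tiling n (T : {set {set cell n}}) : bool :=
  partition T [set: cell n] &&
  [forall B in T, is_square B || is_domino B].

(* A segment lies in the interior of a domino when it is an edge of both of
   its cells. *)
Definition interior_segment n (D : {set cell n}) (u v : vertex n) : bool :=
  [forall c in D, cell_edge c u v].

Definition allowed_step n (T : {set {set cell n}}) (u v : vertex n) : bool :=
  unit_step u v &&
  [forall D in T, is_domino D ==> ~~ interior_segment D u v].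

(* [P] lists the n + 2 vertices visited after the starting corner (0, 0). *)
Definition is_walk n (T : {set {set cell n}})
    (P : (n.+2).-tuple (vertex n)) : bool :=
  path (allowed_step T) (ord0, ord0) P &&
  (last (ord0, ord0) P == (ord_max, ord_max)).

Definition w (n : nat) : nat :=
  #|[set TP : {set {set cell n}} * (n.+2).-tuple (vertex n)
     | is_tiling TP.1 && is_walk TP.1 TP.2]|.

Local Open Scope ring_scope.

(* Because of truncated subtraction on [nat], the values below are the intended
   ones only for n >= 1 ([y_seq]), n >= 3 ([x_seq]) and n >= 6 ([r_seq]). *)
Definition y_seq (n : nat) : int := (w n)%:Z + (w (n - 1))%:Z.

Definition x_seq (n : nat) : int :=
  y_seq n - 3 * y_seq (n - 1)%N + y_seq (n - 2)%N.

Definition r_seq (n : nat) : int :=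
  x_seq n - 3 * x_seq (n - 1)%N - x_seq (n - 2)%N + x_seq (n - 3)%N.

(* Main.v *)
Require Import Defs.
From mathcomp Require Import all_boot all_order all_algebra.
From mathcomp Require Import zify.

(* A tiling of the 2 x n board is determined by the word whose i-th letter tells
   which dominoes stand in, or start in, column i, and the words that occur are
   those satisfying a condition on consecutive letters.  A walk only interacts
   with the letters around its current position, so the number of walks, summed
   over all completions of a partially read word, obeys a linear transfer
   recursion whose state is the pair (last letter, current height).  The
   recurrence for w is a linear consequence of nine steps of this recursion. *)

Set Implicit Arguments.
Unset Strict Implicit.
Unset Printing Implicit Defensive.

Local Open Scope nat_scope.

(* A column of a tiled board: is it covered by a vertical domino, and does a
   horizontal domino start in its lower, upper cell? *)
Definition column : finType := (bool * bool * bool)%type.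
Definition vert (c : column) := c.1.1.
Definition low (c : column) := c.1.2.
Definition upp (c : column) := c.2.
Definition hor (c : column) (j : nat) := if j is 0 then low c else upp c.
(** Serves both as the fictitious column left of the board and as the default value beyond its right
    end. *)
Definition empty_col : column := (false, false, false).

(** Each clause forbids two dominoes on one cell. Horizontal dominoes starting in the previous
    column [p] reach into [c]; a vertical one in [p] does not, so [vert p] is unconstrained. *)
Definition compat (p c : column) : bool :=
  [&& ~~ (vert c && low c), ~~ (vert c && upp c),
      ~~ (low p && vert c), ~~ (upp p && vert c),
      ~~ (low p && low c) & ~~ (upp p && upp c)].


(** A horizontal domino starting in the last column would leave the board. *)
Definition closing (c : column) : bool := ~~ low c && ~~ upp c.

Definition valid_code (s : seq column) : bool :=
  path compat empty_col s && closing (last empty_col s).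

(** * Cell coordinates, adjacency and dominoes *)

Definition pos n (x : cell n) : nat * nat := (val x.1, val x.2).

Lemma pos_inj n : injective (@pos n).
Proof.
by move=> [x1 x2] [y1 y2] [/val_inj /= -> /val_inj /= ->].
Qed.

Lemma pos1_lt n (x : cell n) : (pos x).1 < n. Proof. exact: ltn_ord. Qed.
Lemma pos2_lt n (x : cell n) : (pos x).2 < 2. Proof. exact: ltn_ord. Qed.

Lemma cell_at n i j : i < n -> j < 2 -> exists x : cell n, pos x = (i, j).
Proof. by move=> hi hj; exists (Ordinal hi, Ordinal hj). Qed.

Definition adj (a b : nat * nat) : bool :=
  (a.1 == b.1) && ((b.2 == a.2.+1) || (a.2 == b.2.+1)) ||
  (a.2 == b.2) && ((b.1 == a.1.+1) || (a.1 == b.1.+1)).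

Lemma adj_sym a b : adj a b = adj b a.
Proof. by rewrite /adj; lia. Qed.

Lemma adj_irr a : adj a a = false.
Proof. by rewrite /adj; lia. Qed.

Lemma adj_neq n (x y : cell n) : adj (pos x) (pos y) -> x != y.
Proof. by apply: contraTneq => ->; rewrite adj_irr. Qed.

Lemma cell_edgeE n (c : cell n) (u v : vertex n) :
  cell_edge c u v =
  [|| [&& v.1 == u.1.+1 :> nat, v.2 == u.2 :> nat, u.1 == (pos c).1 :> nat
        & (u.2 == (pos c).2 :> nat) || (u.2 == (pos c).2.+1 :> nat)]
    | [&& v.1 == u.1 :> nat, v.2 == u.2.+1 :> nat, u.2 == (pos c).2 :> nat
        & (u.1 == (pos c).1 :> nat) || (u.1 == (pos c).1.+1 :> nat)]].
Proof.
rewrite /cell_edge /unit_step /right_step /up_step /corner /pos /=.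
move: (nat_of_ord u.1) (nat_of_ord u.2) (nat_of_ord v.1) (nat_of_ord v.2).
move: (nat_of_ord c.1) (nat_of_ord c.2) => c1 c2 u1 u2 v1 v2.
by lia.
Qed.

Lemma common_edge_adj n (c d : cell n) (u v : vertex n) :
  c != d -> cell_edge c u v -> cell_edge d u v -> adj (pos c) (pos d).
Proof.
move=> ncd; have : pos c != pos d by rewrite (inj_eq (@pos_inj n)).
rewrite !cell_edgeE /adj.
case: (pos c) (pos d) => [c1 c2] [d1 d2]; rewrite xpair_eqE /=.
move: (nat_of_ord u.1) (nat_of_ord u.2) (nat_of_ord v.1) (nat_of_ord v.2).
by move=> u1 u2 v1 v2; lia.
Qed.

Lemma is_dominoP n (B : {set cell n}) :
  reflect (exists c d, B = [set c; d] /\ adj (pos c) (pos d)) (is_domino B).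
Proof.
apply: (iffP existsP) => [[c /existsP[d]]|[c [d [-> acd]]]].
  case/and3P=> /eqP-> ncd /existsP[u /existsP[v /andP[cuv duv]]].
  by exists c, d; split=> //; apply: common_edge_adj cuv duv.
exists c; apply/existsP; exists d; rewrite eqxx (adj_neq acd) /=.
have hc := pos1_lt c; have hd := pos1_lt d.
have hc2 := pos2_lt c; have hd2 := pos2_lt d.
(* The edge shared by two adjacent cells runs from the componentwise maximum of their positions to
   the componentwise minimum plus (1, 1). *)
have h1 : maxn (pos c).1 (pos d).1 < n.+1 by lia.
have h2 : maxn (pos c).2 (pos d).2 < 3 by lia.
have h3 : (minn (pos c).1 (pos d).1).+1 < n.+1 by lia.
have h4 : (minn (pos c).2 (pos d).2).+1 < 3 by lia.
apply/existsP; exists (Ordinal h1, Ordinal h2).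
apply/existsP; exists (Ordinal h3, Ordinal h4).
rewrite !cell_edgeE /=; move: acd {h1 h2 h3 h4 hc hd hc2 hd2}; rewrite /adj /=.
move: (nat_of_ord c.1) (nat_of_ord c.2) (nat_of_ord d.1) (nat_of_ord d.2).
by move=> c1 c2 d1 d2; lia.
Qed.

(** * Reading a word of columns off a tiling *)

Definition linked n (T : {set {set cell n}}) (a b : nat * nat) : bool :=
  [exists x : cell n, exists y : cell n,
    [&& pos x == a, pos y == b & [set x; y] \in T]].

Lemma linkedP n (T : {set {set cell n}}) a b :
  reflect (exists x y, [/\ pos x = a, pos y = b & [set x; y] \in T])
          (linked T a b).
Proof.
apply: (iffP existsP) => [[x /existsP[y]]|[x [y [xa yb xyT]]]].
  by case/and3P=> /eqP xa /eqP yb xyT; exists x, y.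
by exists x; apply/existsP; exists y; rewrite xa yb !eqxx.
Qed.

Lemma linked_pos n (T : {set {set cell n}}) x y :
  linked T (pos x) (pos y) = ([set x; y] \in T).
Proof.
apply/linkedP/idP => [[x' [y' [/pos_inj-> /pos_inj->]]] //|xyT].
by exists x, y.
Qed.

Lemma linked_sym n (T : {set {set cell n}}) a b : linked T a b = linked T b a.
Proof.
by apply/linkedP/linkedP => -[x [y [? ? ?]]]; exists y, x; rewrite setUC.
Qed.

Lemma linked_lt n (T : {set {set cell n}}) a b : linked T a b -> b.1 < n.
Proof. by case/linkedP=> x [y [_ <- _]]; apply: pos1_lt. Qed.

Definition column_of n (T : {set {set cell n}}) (i : nat) : column :=
  (linked T (i, 0) (i, 1), linked T (i, 0) (i.+1, 0), linked T (i, 1) (i.+1, 1)).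

Lemma column_of_out n (T : {set {set cell n}}) i :
  n <= i -> column_of T i = empty_col.
Proof.
move=> le_ni; rewrite /column_of /empty_col.
congr (_, _, _); apply: contraTF le_ni => /linked_lt /=; lia.
Qed.

Definition encode n (T : {set {set cell n}}) : n.-tuple column :=
  [tuple column_of T i | i < n].

Lemma nth_encode n (T : {set {set cell n}}) i :
  nth empty_col (encode T) i = column_of T i.
Proof.
have [lt_in|le_ni] := ltnP i n; last first.
  by rewrite nth_default ?size_tuple // column_of_out.
rewrite -[i]/(nat_of_ord (Ordinal lt_in)) -tnth_nth.
by rewrite tnth_mktuple.
Qed.

(** Counterpart of [linked] computed from the word alone; it will generate the tiles of the decoded
    tiling. *)
Definition joined (s : seq column) (a b : nat * nat) : bool :=
  [|| (a.1 == b.1) && ((b.2 == a.2.+1) || (a.2 == b.2.+1))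
        && vert (nth empty_col s a.1),
      [&& b.1 == a.1.+1, a.2 == b.2 & hor (nth empty_col s a.1) a.2]
    | [&& a.1 == b.1.+1, a.2 == b.2 & hor (nth empty_col s b.1) a.2]].

Lemma joined_sym s a b : joined s a b = joined s b a.
Proof.
rewrite /joined; case: a b => [a1 a2] [b1 b2] /=.
have [->|_] := eqVneq a1 b1; have [->|_] := eqVneq a2 b2; rewrite ?andbF ?orbF //=.
all: by rewrite orbC.
Qed.

Lemma joined_adj s a b : joined s a b -> adj a b.
Proof.
rewrite /joined /adj => /or3P[/andP[-> //]|/and3P[-> -> _]|/and3P[-> -> _]];
by rewrite ?orbT.
Qed.

(** The factor [adj] matters: a unit square at [x] is [[set x; x]], so [linked] can relate a
    position to itself while [joined] cannot. *)
Lemma joined_encode n (T : {set {set cell n}}) (x y : cell n) :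
  joined (encode T) (pos x) (pos y) =
  adj (pos x) (pos y) && ([set x; y] \in T).
Proof.
rewrite -linked_pos /joined /adj !nth_encode /vert /hor /low /upp /column_of.
have := pos2_lt x; have := pos2_lt y.
case: (pos x) (pos y) => [x1 x2] [y1 y2] /= hy hx.
have [<-|nxy1] := eqVneq x1 y1.
  have [e1 e2] : (x1 == x1.+1) = false /\ (x1.+1 == x1) = false by lia.
  rewrite e1 ?e2 /= !andbF !orbF.
  move: x2 y2 hx hy {e1 e2} => [|[|//]] [|[|//]] //= _ _.
  by rewrite linked_sym.
rewrite /=; have [<-|_] := eqVneq x2 y2; last by rewrite !andbF.
rewrite /=; have [->|_] /= := eqVneq y1 x1.+1.
  have -> : (x1 == x1.+2) = false by lia.
  by move: x2 hx {hy} => [|[|//]] //= _; rewrite orbF.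
have [->|//] /= := eqVneq x1 y1.+1.
by move: x2 hx {hy} => [|[|//]] //= _; rewrite linked_sym.
Qed.

(** * Tilings yield valid words *)

Section TilingToCode.
Variables (n : nat) (T : {set {set cell n}}).
Hypothesis tilT : is_tiling T.

Let partT : partition T [set: cell n].
Proof. by case/andP: tilT. Qed.

Let trivT : trivIset T.
Proof. by case/and3P: partT. Qed.

Let coverT x : x \in cover T.
Proof. by case/and3P: partT => /eqP->. Qed.

Lemma linked_pblock (x y : cell n) : [set x; y] \in T -> pblock T x = [set x; y].
Proof. by move=> xyT; apply: def_pblock => //; rewrite set21. Qed.

(** Both tiles contain the cell at [a], so they are the same block of the partition, and [b], [b']
    are both its other cell. *)
Lemma linked_inj a b b' :
  linked T a b -> linked T a b' -> a != b -> b = b'.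
Proof.
case/linkedP=> x [y [<- <- xyT]] /linkedP[x' [y' [/pos_inj-> <- xyT']]].
rewrite (inj_eq (@pos_inj n)) => nxy.
have := set22 x y; rewrite -(linked_pblock xyT) (linked_pblock xyT') !inE.
by rewrite eq_sym (negPf nxy) => /eqP->.
Qed.

(** The word determines the tile of every cell; this is what makes decoding an encoded tiling return
    that tiling. *)
Lemma mem_pblock_tiling (x y : cell n) :
  (y \in pblock T x) = (y == x) || joined (encode T) (pos x) (pos y).
Proof.
rewrite joined_encode; apply/idP/orP; last first.
  case=> [/eqP->|/andP[_ /linked_pblock->]]; last by rewrite set22.
  by rewrite mem_pblock.
have xB : x \in pblock T x by rewrite mem_pblock.
have BT : pblock T x \in T by rewrite pblock_mem.
case/andP: tilT => _ /forall_inP /(_ _ BT) /orP[/existsP[c /eqP eB]|].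
  by move: xB; rewrite eB !inE => /eqP-> /eqP->; left.
case/is_dominoP=> c [d [eB acd]]; move: xB BT; rewrite eB !inE.
case/orP=> /eqP-> cdT /orP[]/eqP->; rewrite ?eqxx; try (by left); right.
  by rewrite acd.
by rewrite adj_sym acd setUC.
Qed.

Lemma linked_excl a b b' :
  a != b -> b != b' -> linked T a b && linked T a b' = false.
Proof.
move=> nab nbb'; apply/andP => -[lab lab'].
by move/eqP: nbb'; apply; apply: linked_inj lab lab' nab.
Qed.

(** A violated clause would give two distinct dominoes sharing a cell, against [linked_excl]; for
    [i = 0] the previous column is the fictitious empty one. *)
Lemma compat_column_of i :
  compat (nth empty_col (empty_col :: encode T) i) (column_of T i).
Proof.
have vl : linked T (i, 0) (i, 1) && linked T (i, 0) (i.+1, 0) = false.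
  by apply: linked_excl; rewrite xpair_eqE; lia.
have vu : linked T (i, 0) (i, 1) && linked T (i, 1) (i.+1, 1) = false.
  by rewrite linked_sym; apply: linked_excl; rewrite xpair_eqE; lia.
rewrite /compat {1 2}/vert {1}/low {1}/upp {1 2 3 4}/column_of [_.1.1]/= vl vu.
case: i {vl vu} => [|i] //; rewrite [nth _ _ _]/= nth_encode.
rewrite /vert /low /upp /column_of /= !(linked_sym T (i, _)).
apply/and4P; split; apply/negbT; last 2 first.
- by apply: linked_excl; rewrite xpair_eqE; lia.
- by apply: linked_excl; rewrite xpair_eqE; lia.
- by apply: linked_excl; rewrite xpair_eqE; lia.
by rewrite (linked_sym T (_, 0) (_, 1)); apply: linked_excl; rewrite xpair_eqE; lia.
Qed.

Lemma valid_encode : valid_code (encode T).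
Proof.
apply/andP; split.
  apply/(pathP empty_col) => i; rewrite size_tuple => lt_in; rewrite nth_encode.
  exact: compat_column_of.
rewrite -nth_last size_tuple nth_encode /closing /low /upp /column_of /=.
by apply/andP; split; apply/negP => /linked_lt /=; lia.
Qed.

End TilingToCode.

(** * Valid words yield tilings *)

Section CodeToTiling.
Variables (n : nat) (s : n.-tuple column).
Hypothesis valid_s : valid_code s.

Definition same_tile : rel (cell n) :=
  fun x y => (y == x) || joined s (pos x) (pos y).

Definition decode : {set {set cell n}} := equivalence_partition same_tile setT.

Lemma compat_nth i : compat (nth empty_col (empty_col :: s) i) (nth empty_col s i).
Proof.
have [lt_in|le_ni] := ltnP i n; last first.
  by rewrite (nth_default _ (_ : size s <= i)) ?size_tuple // /compat !andbF.
by case/andP: valid_s => /(pathP empty_col) h _; apply: h; rewrite size_tuple.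
Qed.

Lemma hor_last i j : n <= i.+1 -> hor (nth empty_col s i) j = false.
Proof.
rewrite leq_eqVlt ltnS => /orP[/eqP ni|le_ni]; last first.
  by rewrite nth_default ?size_tuple //; case: j.
case/andP: valid_s => _; rewrite -nth_last size_tuple.
have -> : n.-1 = i by rewrite ni.
by case/andP=> /negPf ? /negPf ?; case: j.
Qed.

Lemma vert_hor i j : vert (nth empty_col s i) -> hor (nth empty_col s i) j -> False.
Proof.
move: (compat_nth i); rewrite /compat => /and3P[vl vu _] v.
by move: vl vu; rewrite v /=; case: j => [|j] /= /negPf l /negPf u; rewrite ?l ?u.
Qed.

Lemma hor_vert i j :
  hor (nth empty_col s i) j -> vert (nth empty_col s i.+1) -> False.
Proof.
move: (compat_nth i.+1); rewrite /compat => /and5P[_ _ lv uv _] h v.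
by move: h lv uv; rewrite v !andbT /=; case: j => [|j] /= ->.
Qed.

Lemma hor_hor i j :
  hor (nth empty_col s i) j -> hor (nth empty_col s i.+1) j -> False.
Proof.
move: (compat_nth i.+1); rewrite /compat => /and5P[_ _ _ _ /andP[ll uu]].
by case: j => [|j] /= h k; [move: ll | move: uu]; rewrite h k.
Qed.

(** Compare the types of the two links: vertical, starting at [a], or ending at [a]. Equal types
    force equal coordinates, using that there are two rows; each of the six mixed cases contradicts
    [compat]. *)
Lemma joined_inj a b b' : a.2 < 2 -> b.2 < 2 -> b'.2 < 2 ->
  joined s a b -> joined s a b' -> b = b'.
Proof.
case: a b b' => [a1 a2] [b1 b2] [c1 c2] /= ha hb hc; rewrite /joined /=.
case/or3P=> [/andP[/andP[/eqP e1 e2] h]|/and3P[/eqP e1 /eqP e2 h]|/and3P[/eqP e1 /eqP e2 h]];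
case/or3P=> [/andP[/andP[/eqP f1 f2] k]|/and3P[/eqP f1 /eqP f2 k]|/and3P[/eqP f1 /eqP f2 k]].
- by congr (_, _); lia.
- by case: (vert_hor h k).
- by rewrite f1 in h; case: (hor_vert k h).
- by case: (vert_hor k h).
- by congr (_, _); lia.
- by rewrite f1 in h; case: (hor_hor k h).
- by rewrite e1 in k; case: (hor_vert h k).
- by rewrite e1 in k; case: (hor_hor h k).
- by congr (_, _); lia.
Qed.

(** Transitivity holds because, by [joined_inj], a cell has at most one partner. *)
Lemma same_tile_equiv : {in setT & &, equivalence_rel same_tile}.
Proof.
move=> x y z _ _ _; split; first by rewrite /same_tile eqxx.
case/orP=> [/eqP->//|jxy].
have jyx : joined s (pos y) (pos x) by rewrite joined_sym.
apply/orP/orP=> -[/eqP->|j].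
- by right.
- left; apply/eqP/pos_inj; apply: joined_inj j jxy; exact: pos2_lt.
- by right.
- left; apply/eqP/pos_inj; apply: joined_inj j jyx; exact: pos2_lt.
Qed.

Lemma mem_decode (x y : cell n) : adj (pos x) (pos y) ->
  ([set x; y] \in decode) = joined s (pos x) (pos y).
Proof.
move=> axy; have nyx : y != x by rewrite eq_sym adj_neq.
apply/imsetP/idP => [[z _ eB]|jxy].
  have := set21 x y; have := set22 x y; rewrite eB !inE /= => zy zx.
  have [_ /(_ zx) e] := same_tile_equiv (in_setT z) (in_setT x) (in_setT y).
  by move: zy; rewrite e /same_tile (negPf nyx).
exists x => //; apply/setP => z; rewrite !inE /= /same_tile.
congr (_ || _); apply/eqP/idP => [->//|jxz].
by apply/pos_inj; apply: joined_inj jxz jxy; exact: pos2_lt.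
Qed.

Lemma tiling_decode : is_tiling decode.
Proof.
apply/andP; split; first exact: equivalence_partitionP same_tile_equiv.
apply/forall_inP=> B /imsetP[x _ ->].
case: (pickP (fun y : cell n => joined s (pos x) (pos y))) => [y jxy|j0]; last first.
  apply/orP; left; apply/existsP; exists x; apply/eqP/setP => y.
  by rewrite !inE /= /same_tile j0 orbF.
apply/orP; right; apply/is_dominoP; exists x, y; split; last exact: joined_adj jxy.
apply/setP => z; rewrite !inE /= /same_tile.
congr (_ || _); apply/idP/eqP => [jxz|->//].
by apply/pos_inj; apply: joined_inj jxz jxy; exact: pos2_lt.
Qed.

Lemma linked_decode a b : a.1 < n -> b.1 < n -> a.2 < 2 -> b.2 < 2 -> adj a b ->
  linked decode a b = joined s a b.
Proof.
case: a b => [a1 a2] [b1 b2] /= ha hb ha2 hb2.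
have [x <-] := cell_at ha ha2; have [y <-] := cell_at hb hb2.
by move=> axy; rewrite linked_pos mem_decode.
Qed.

Lemma encode_decode : encode decode = s.
Proof.
apply/val_inj/(@eq_from_nth _ empty_col) => [|i]; rewrite ?size_tuple // => lt_in.
have linkE j : j < 2 -> linked decode (i, j) (i.+1, j) = hor (nth empty_col s i) j.
  (* When column [i] is the last one, both sides are false: the target cell is off the board, and
     [closing] excludes the horizontal domino. *)
  move=> hj; have [lt_in1|le_ni] := ltnP i.+1 n; last first.
    by rewrite hor_last //; apply: contraTF le_ni => /linked_lt /=; lia.
  rewrite linked_decode //= /adj /joined /= ?eqxx ?orbT //=.
  have -> : (i == i.+1) = false by lia.
  have -> : (i == i.+2) = false by lia.
  by rewrite orbF.
rewrite nth_encode /column_of !linkE // linked_decode //= /adj /joined /= ?eqxx //=.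
have -> : (i == i.+1) = false by lia.
by rewrite orbF; case: (nth empty_col s i) => [[]].
Qed.

End CodeToTiling.

(** * The bijection between tilings and valid words *)

Lemma decode_encode n (T : {set {set cell n}}) :
  is_tiling T -> decode (encode T) = T.
Proof.
move=> tilT; case/andP: (tilT) => partT _.
rewrite -[RHS](equivalence_partition_pblock partT).
apply: eq_imset => x; apply/setP => y; rewrite !inE /=.
by rewrite mem_pblock_tiling.
Qed.

Lemma sum_tilings n (f : n.-tuple column -> nat) :
  \sum_(T | is_tiling T) f (encode T) = \sum_(s | valid_code (val s)) f s.
Proof.
rewrite (reindex_onto (@encode n) (@decode n)); last first.
  by move=> s /encode_decode.
apply: eq_bigl => T; apply/idP/andP => [tilT|[vT /eqP <-]].
  by rewrite valid_encode // decode_encode.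
exact: tiling_decode.
Qed.

(** * Sums over tuples and path counts *)

Lemma big_tupleS (A : finType) m (P : pred (seq A)) (f : seq A -> nat) :
  \sum_(s : m.+1.-tuple A | P s) f s =
  \sum_(c : A) \sum_(s : m.-tuple A | P (c :: s)) f (c :: s).
Proof.
rewrite pair_big_dep /=.
rewrite (reindex (fun cs : A * m.-tuple A => cons_tuple cs.1 cs.2)) //=.
exists (fun s : m.+1.-tuple A => (thead s, behead_tuple s)) => [[c s] _|s _] /=.
  by congr pair; apply/val_inj.
by rewrite [RHS]tuple_eta; apply/val_inj.
Qed.

Definition count_paths (V : finType) (e : rel V) (y : V) m (x : V) : nat :=
  \sum_(P : m.-tuple V | path e x P && (last x P == y)) 1.

Lemma count_paths0 (V : finType) (e : rel V) (y x : V) :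
  count_paths e y 0 x = (x == y).
Proof.
rewrite /count_paths (eq_bigl (fun P => (P == [tuple]) && (x == y))) => [|P]; last first.
  by rewrite tuple0 eqxx.
case: (x == y); last by rewrite big_pred0 // => P; rewrite andbF.
by rewrite (eq_bigl (pred1 [tuple])) ?big_pred1_eq // => P; rewrite andbT.
Qed.

Lemma count_pathsS (V : finType) (e : rel V) (y x : V) m :
  count_paths e y m.+1 x = \sum_(z | e x z) count_paths e y m z.
Proof.
rewrite /count_paths (big_tupleS m (fun P => path e x P && (last x P == y)) (fun _ => 1)).
rewrite [RHS]big_mkcond; apply: eq_bigr => z _ /=.
by case: (e x z) => //=; rewrite big_pred0.
Qed.

Lemma w_sum n : w n =
  \sum_(T | @is_tiling n T)
    count_paths (allowed_step T) (ord_max, ord_max) n.+2 (ord0, ord0).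
Proof.
rewrite /w -sum1_card /count_paths pair_big_dep /=.
by apply: eq_bigl => -[T P]; rewrite inE.
Qed.

(** * Steps of a walk in terms of the word *)

(** At heights 0 and 2 the segment lies on the border; at height 1 it separates the two cells of its
    column, so only a vertical domino can block it. *)
Lemma allowed_right n (T : {set {set cell n}}) (u v : vertex n) :
  right_step u v ->
  allowed_step T u v = ~~ ((u.2 == 1 :> nat) && vert (column_of T u.1)).
Proof.
move=> uv; rewrite /allowed_step /unit_step uv /=.
rewrite -[LHS]negbK; congr negb; rewrite negb_forall_in.
apply/exists_inP/andP => [[D DT]|[/eqP u2 /linkedP[x [y [xp yp xyT]]]]].
  rewrite negb_imply negbK => /andP[/is_dominoP[c [d [eD acd]]] /forall_inP iD].
  have := iD c; have := iD d; rewrite eD set21 set22 => /(_ isT) + /(_ isT).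
  move: DT; rewrite eD -linked_pos !cell_edgeE /vert.
  move: acd uv (pos2_lt c) (pos2_lt d); rewrite /adj /right_step /column_of.
  rewrite {iD eD}.
  case: (pos c) (pos d) => [c1 c2] [d1 d2] /=.
  move: (nat_of_ord u.1) (nat_of_ord u.2) (nat_of_ord v.1) (nat_of_ord v.2).
  move=> u1 u2 v1 v2 acd uv hc hd lcd hd' hc'.
  have [h1 [h2 h3]] : u2 = 1 /\ c1 = u1 /\ d1 = u1 by lia.
  have : (c2 = 0 /\ d2 = 1) \/ (c2 = 1 /\ d2 = 0) by lia.
  move: lcd; rewrite h1 h2 h3 => lcd [[e1 e2]|[e1 e2]]; move: lcd; rewrite e1 e2 //.
  by rewrite linked_sym.
exists [set x; y] => //; rewrite negb_imply negbK; apply/andP; split.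
  by apply/is_dominoP; exists x, y; split=> //; rewrite xp yp /adj /= eqxx.
move: uv; rewrite /right_step => /andP[/eqP v1 /eqP v2].
apply/forall_inP=> z; rewrite !inE => /orP[]/eqP->; rewrite cell_edgeE ?xp ?yp /=;
by rewrite v1 v2 u2 !eqxx.
Qed.

(** The segment at abscissa [u.1] separates columns [u.1 - 1] and [u.1]. Prepending [empty_col]
    shifts the word, so entry [u.1] is the column on the left, and the left border is never
    blocked. *)
Lemma allowed_up n (T : {set {set cell n}}) (u v : vertex n) :
  up_step u v ->
  allowed_step T u v = ~~ hor (nth empty_col (empty_col :: encode T) u.1) u.2.
Proof.
move=> uv; rewrite /allowed_step /unit_step uv orbT /=.
have horE : hor (nth empty_col (empty_col :: encode T) u.1) u.2 =
    (0 < u.1) && linked T (u.1.-1, val u.2) (u.1 : nat, val u.2).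
  have : u.2 < 2 by move: uv (ltn_ord v.2); rewrite /up_step; lia.
  case: (nat_of_ord u.1) => [|i] /=; first by case: (nat_of_ord u.2).
  by rewrite nth_encode; case: (nat_of_ord u.2) => [|[|//]].
rewrite horE -[LHS]negbK; congr negb; rewrite negb_forall_in.
apply/exists_inP/andP => [[D DT]|[u1 /linkedP[x [y [xp yp xyT]]]]].
  rewrite negb_imply negbK => /andP[/is_dominoP[c [d [eD acd]]] /forall_inP iD].
  have := iD c; have := iD d; rewrite eD set21 set22 => /(_ isT) + /(_ isT).
  move: DT; rewrite eD -linked_pos !cell_edgeE.
  move: acd uv; rewrite /adj /up_step {iD eD horE}.
  case: (pos c) (pos d) => [c1 c2] [d1 d2] /=.
  move: (nat_of_ord u.1) (nat_of_ord u.2) (nat_of_ord v.1) (nat_of_ord v.2).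
  move=> u1 u2 v1 v2 acd uv lcd hd' hc'.
  have [h1 [h2 h3]] : 0 < u1 /\ c2 = u2 /\ d2 = u2 by lia.
  split=> //.
  have : (c1 = u1.-1 /\ d1 = u1) \/ (c1 = u1 /\ d1 = u1.-1) by lia.
  move: lcd; rewrite h2 h3 => lcd [[e1 e2]|[e1 e2]]; move: lcd; rewrite e1 e2 //.
  by rewrite linked_sym.
exists [set x; y] => //; rewrite negb_imply negbK; apply/andP; split.
  by apply/is_dominoP; exists x, y; split=> //; rewrite xp yp /adj /= prednK // !eqxx orbT.
move: uv; rewrite /up_step => /andP[/eqP v1 /eqP v2].
apply/forall_inP=> z; rewrite !inE => /orP[]/eqP->; rewrite cell_edgeE ?xp ?yp /=;
by rewrite v1 v2 ?prednK // !eqxx ?orbT.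
Qed.

Definition vtx n (i j : nat) : vertex n := (inord i, inord j).

Lemma sum_at_most_one (V : finType) (P : pred V) (b : bool) (x : V) (f : V -> nat) :
  P =1 (fun z => b && (z == x)) -> \sum_(z | P z) f z = b * f x.
Proof.
move=> eqP'; rewrite (eq_bigl _ _ eqP'); case: b {eqP'} => /=.
  by rewrite big_pred1_eq mul1n.
by rewrite big_pred0.
Qed.

(** At most two steps leave a vertex. On the right or top border [inord] sends the missing target to
    a junk vertex, but its coefficient is then 0. *)
Lemma sum_allowed n (T : {set {set cell n}}) i j (f : vertex n -> nat) :
  i <= n -> j <= 2 ->
  \sum_(z | allowed_step T (vtx n i j) z) f z =
  ((i < n) && ~~ ((j == 1) && vert (column_of T i))) * f (vtx n i.+1 j) +
  ((j < 2) && ~~ hor (nth empty_col (empty_col :: encode T) i) j)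
    * f (vtx n i j.+1).
Proof.
move=> le_in le_j2; set u := vtx n i j.
have u1 : u.1 = i :> nat by rewrite inordK.
have u2 : u.2 = j :> nat by rewrite inordK.
have vtxE (z : vertex n) i' j' : i' <= n -> j' <= 2 ->
    (z == vtx n i' j') = (z.1 == i' :> nat) && (z.2 == j' :> nat).
  by move=> hi hj; case: z => z1 z2; rewrite [LHS]xpair_eqE -!val_eqE /= !inordK.
rewrite (bigID (right_step u)) /=; congr addn; apply: sum_at_most_one => z.
  have [uz|nuz] := boolP (right_step u z); rewrite ?andbF ?andbT.
    rewrite allowed_right // u1 u2; move: uz; rewrite /right_step u1 u2.
    case/andP=> /eqP z1 /eqP z2; have lt_in : i < n by rewrite -ltnS -z1 ltn_ord.
    by rewrite vtxE // z1 z2 lt_in !eqxx !andbT.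
  case: ltnP => //= lt_in; rewrite vtxE //; move: nuz.
  by rewrite /right_step u1 u2 => /negPf->; rewrite andbF.
have [uz|nuz] := boolP (up_step u z).
  rewrite allowed_up // u1 u2; move: uz; rewrite /up_step /right_step u1 u2.
  case/andP=> /eqP z1 /eqP z2; have lt_j2 : j < 2 by rewrite -ltnS -z2 ltn_ord.
  rewrite vtxE // z1 z2 lt_j2 !eqxx !andbT.
  have -> : (i == i.+1) = false by lia.
  by rewrite andbT.
rewrite /allowed_step /unit_step (negPf nuz) orbF andbAC andbN /=.
case: ltnP => //= lt_j2; rewrite vtxE //; move: nuz.
by rewrite /up_step u1 u2 => /negPf->; rewrite andbF.
Qed.

(* Walks from height 1, resp. 0, to the far corner, when [p] is the column just
   passed and [s] lists the columns ahead; from height 2 there is a single one. *)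
Fixpoint walks1 (p : column) (s : seq column) : nat :=
  ~~ upp p + if s is c :: s' then ~~ vert c * walks1 c s' else 0.

Fixpoint walks0 (p : column) (s : seq column) : nat :=
  ~~ low p * walks1 p s + if s is c :: s' then walks0 c s' else 0.

(** Induction on the number [d] of columns ahead; from height [j] exactly [d + (2 - j)] steps
    remain, which fixes the three path lengths. *)
Lemma count_walks_at n (T : {set {set cell n}}) d i : i + d = n ->
  let cnt := count_paths (allowed_step T) (ord_max, ord_max) in
  let p := nth empty_col (empty_col :: encode T) i in
  [/\ cnt d (vtx n i 2) = 1, cnt d.+1 (vtx n i 1) = walks1 p (drop i (encode T))
    & cnt d.+2 (vtx n i 0) = walks0 p (drop i (encode T))].
Proof.
elim: d i => [|d IHd] i id_n cnt p.
  have le_in : i <= n by lia.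
  have ltF : (i < n) = false by lia.
  have c0 : cnt 0 (vtx n i 2) = 1.
    rewrite /cnt count_paths0; apply/eqP; rewrite eqb1; apply/eqP.
    by congr pair; apply: val_inj; rewrite /= inordK //; lia.
  have c1 : cnt 1 (vtx n i 1) = ~~ upp p.
    by rewrite /cnt count_pathsS sum_allowed // ltF -/cnt c0 muln1.
  have c2 : cnt 2 (vtx n i 0) = ~~ low p * ~~ upp p.
    by rewrite /cnt count_pathsS sum_allowed // ltF -/cnt c1.
  rewrite c0 c1 c2 drop_oversize ?size_tuple //=; last by lia.
  by rewrite !addn0.
have lt_in : i < n by lia.
have le_in : i <= n by lia.
have [c0 c1 c2] : [/\ cnt d (vtx n i.+1 2) = 1,
    cnt d.+1 (vtx n i.+1 1) = walks1 (column_of T i) (drop i.+1 (encode T))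
  & cnt d.+2 (vtx n i.+1 0) = walks0 (column_of T i) (drop i.+1 (encode T))].
  by rewrite -nth_encode; apply: (IHd i.+1); lia.
rewrite (drop_nth empty_col) ?size_tuple // nth_encode.
have e0 : cnt d.+1 (vtx n i 2) = 1.
  by rewrite /cnt count_pathsS sum_allowed // lt_in -/cnt c0.
have e1 : cnt d.+2 (vtx n i 1) =
    walks1 p (column_of T i :: drop i.+1 (encode T)).
  by rewrite /cnt count_pathsS sum_allowed // lt_in -/cnt c1 e0 /= muln1 addnC.
split=> //.
rewrite /cnt count_pathsS sum_allowed // lt_in -/cnt c2 e1.
by rewrite [RHS]/= mul1n addnC.
Qed.

Lemma w_codes n :
  w n = \sum_(s : n.-tuple column | valid_code s) walks0 empty_col s.
Proof.
rewrite w_sum -(sum_tilings (walks0 empty_col)); apply: eq_bigr => T _.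
have [_ _ /=] := @count_walks_at n T n 0 (add0n n).
rewrite drop0 => <-; congr count_paths; congr pair; apply: val_inj;
by rewrite /= inordK.
Qed.

(** * The transfer recursion *)

(** Sums [f] over the completions of a partially read word: [p] is its last column and [n] columns
    remain. *)
Definition code_sum (f : column -> seq column -> nat) (n : nat) (p : column) : nat :=
  \sum_(s : n.-tuple column | path compat p s && closing (last p s)) f p s.

Lemma code_sum0 f p : code_sum f 0 p = closing p * f p [::].
Proof.
rewrite /code_sum (@sum_at_most_one _ _ (closing p) [tuple]) // => s.
by rewrite tuple0 eqxx andbT.
Qed.

Lemma code_sumS f n p :
  code_sum f n.+1 p =
  \sum_(c | compat p c)
    \sum_(s : n.-tuple column | path compat c s && closing (last c s)) f p (c :: s).
Proof.
rewrite /code_sum (big_tupleS n (fun s => path compat p s && closing (last p s)) (f p)).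
rewrite [RHS]big_mkcond; apply: eq_bigr => c _ /=.
by case: (compat p c) => //=; rewrite big_pred0.
Qed.

Definition tilings_after := code_sum (fun _ _ => 1).
Definition walks1_after := code_sum walks1.
Definition walks0_after := code_sum walks0.

Lemma tilings_afterS n p : tilings_after n.+1 p = \sum_(c | compat p c) tilings_after n c.
Proof. exact: code_sumS. Qed.

(** Stepping up to height 2 leaves a single walk per completion, whence the term in [tilings_after];
    a vertical domino in the next column blocks the step right. *)
Lemma walks1_afterS n p : walks1_after n.+1 p =
  ~~ upp p * tilings_after n.+1 p + \sum_(c | compat p c) ~~ vert c * walks1_after n c.
Proof.
rewrite /walks1_after code_sumS tilings_afterS big_distrr -big_split; apply: eq_bigr => c _ /=.
rewrite big_split /tilings_after /code_sum /= !big_distrr /=; congr addn.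
by under [RHS]eq_bigr do rewrite muln1.
Qed.

Lemma walks0_afterS n p : walks0_after n.+1 p =
  ~~ low p * walks1_after n.+1 p + \sum_(c | compat p c) walks0_after n c.
Proof.
rewrite /walks0_after code_sumS /walks1_after code_sumS big_distrr -big_split.
by apply: eq_bigr => c _ /=; rewrite big_split /= big_distrr.
Qed.

Definition colL : column := (false, true, false).
Definition colU : column := (false, false, true).
Definition colLU : column := (false, true, true).
Definition colV : column := (true, false, false).

Lemma sum_column (f : column -> nat) :
  \sum_(c : column) f c = \sum_v \sum_l \sum_u f (v, l, u).
Proof. by rewrite pair_bigA pair_bigA; apply: eq_bigr => -[[]]. Qed.

Lemma sum_compat a b (f : column -> nat) :
  \sum_(c | compat (false, a, b) c) f c =
  f empty_col + ~~ (a || b) * f colV + ~~ a * f colL + ~~ b * f colU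
  + ~~ (a || b) * f colLU.
Proof.
rewrite big_mkcond sum_column !big_bool /=.
by case: a; case: b; rewrite /compat /empty_col /colV /colL /colU /colLU /=; lia.
Qed.

(** A vertical domino does not reach into the next column, so it admits the same completions as an
    empty column. This cuts the five possible columns down to four states. *)
Lemma code_sum_colV f n : (forall s, f colV s = f empty_col s) ->
  code_sum f n colV = code_sum f n empty_col.
Proof. by move=> ef; apply: eq_big => [[[|c s] ?] | s _]. Qed.

Lemma w_walks0_after n : w n = walks0_after n empty_col.
Proof. exact: w_codes. Qed.

Local Open Scope ring_scope.

(** Three counts times four states give twelve sequences. The coefficient 2 merges an empty next
    column with a vertical one; it is absent from [B'], where a vertical domino blocks the walk. *)
Lemma transfer_step n :
  let T := tilings_after n in let B := walks1_after n in let A := walks0_after n in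
  let T' := tilings_after n.+1 in let B' := walks1_after n.+1 in let A' := walks0_after n.+1 in
  let O := empty_col in
  [/\ [/\ T' O = 2 * T O + T colL + T colU + T colLU,
      T' colL = T O + T colU, T' colU = T O + T colL & T' colLU = T O],
      [/\ B' O = T' O + B O + B colL + B colU + B colLU,
      B' colL = T' colL + B O + B colU, B' colU = B O + B colL & B' colLU = B O] &
      [/\ A' O = B' O + 2 * A O + A colL + A colU + A colLU,
      A' colL = A O + A colU, A' colU = B' colU + A O + A colL & A' colLU = A O]]%N.
Proof.
have eV2 : tilings_after n colV = tilings_after n empty_col by apply: code_sum_colV.
have eV0 : walks0_after n colV = walks0_after n empty_col by apply: code_sum_colV; case.
move=> /=; split.
- by rewrite !tilings_afterS !sum_compat eV2 /=; split; lia.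
- by rewrite !walks1_afterS !sum_compat /=; split; lia.
- by rewrite !walks0_afterS !sum_compat eV0 /=; split; lia.
Qed.

(* The recurrence holds for every initial vector of the twelve transfer
   sequences, hence follows linearly from nine consecutive transfer steps. *)
Lemma w_rec n :
  (w (n + 9))%:Z =
    8 * (w (n + 8))%:Z - 17 * (w (n + 7))%:Z - 7 * (w (n + 6))%:Z
    + 41 * (w (n + 5))%:Z + (w (n + 4))%:Z - 23 * (w (n + 3))%:Z
    + 3 * (w (n + 2))%:Z + 4 * (w (n + 1))%:Z - (w n)%:Z.
Proof.
rewrite !addnS addn0 !w_walks0_after.
have := transfer_step n. have := transfer_step n.+1. have := transfer_step n.+2.
have := transfer_step n.+3. have := transfer_step n.+4. have := transfer_step n.+1.+4.
have := transfer_step n.+2.+4. have := transfer_step n.+3.+4. have := transfer_step n.+4.+4.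
do 9!move=> [[????][????][????]].
lia.
Qed.

(** * Initial values and the final statement *)

Lemma w_init :
  [/\ w 0 = 1, w 1 = 5 & w 2 = 28]%N /\
  [/\ w 3 = 130, w 4 = 569 & w 5 = 2352]%N /\
  [/\ w 6 = 9363, w 7 = 36183 & w 8 = 136663]%N.
Proof.
(* With no column left all three counts equal [closing p], since a closing column blocks no upward
   step; this starts the recursion. *)
have E2 p : tilings_after 0 p = closing p by rewrite /tilings_after code_sum0 muln1.
have E1 p : walks1_after 0 p = closing p.
  by rewrite /walks1_after code_sum0 /closing /=; case: (upp p); rewrite ?andbF ?muln1.
have E0 p : walks0_after 0 p = closing p.
  rewrite /walks0_after code_sum0 /closing /=.
  by case: (low p); case: (upp p).
rewrite !w_walks0_after E0.
have H0 := transfer_step 0; rewrite /= !E0 !E1 !E2 /closing /low /upp /= in H0; move: H0 => {E0 E1 E2}.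
have := transfer_step 1. have := transfer_step 2.
have := transfer_step 3. have := transfer_step 4. have := transfer_step 5.
have := transfer_step 6. have := transfer_step 7.
do 8!move=> [[????][????][????]].
(* Literals above 5000 are kept in decimal form, which [lia] does not read. *)
cbv [Nat.of_num_uint Nat.of_uint Nat.of_uint_acc]; rewrite !PeanoNat.Nat.tail_mul_spec.
by do !split; lia.
Qed.

Theorem theorem2 :
  [/\ forall n : nat, (9 <= n)%N ->
        (w n)%:Z =
          8 * (w (n - 1))%:Z - 17 * (w (n - 2))%:Z - 7 * (w (n - 3))%:Z
          + 41 * (w (n - 4))%:Z + (w (n - 5))%:Z - 23 * (w (n - 6))%:Z
          + 3 * (w (n - 7))%:Z + 4 * (w (n - 8))%:Z - (w (n - 9))%:Z,
      [/\ w 0 = 1%N, w 1 = 5%N & w 2 = 28%N] /\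
      [/\ w 3 = 130%N, w 4 = 569%N & w 5 = 2352%N] /\
      [/\ w 6 = 9363%N, w 7 = 36183%N & w 8 = 136663%N] &
      forall n : nat, (9 <= n)%N ->
        r_seq n = 3 * r_seq (n - 1)%N + r_seq (n - 2)%N - r_seq (n - 3)%N].
Proof.
(* Writing [n] as [n + 9] removes all truncated subtractions. *)
split; [| exact: w_init |] => n /subnK <-; move: (n - 9)%N => {}n.
  by rewrite w_rec !addnS addn0 !subSS !subn0.
(* Both recurrences expand to the same relation: the characteristic polynomial factors as [(1 + z)(1
   - 3z + z^2)(1 - 3z - z^2 + z^3)^2]. The factors give [y], [x], [r] and the recurrence of [r], the
   last cubic being used twice. *)
have := w_rec n; rewrite /r_seq /x_seq /y_seq !addnS addn0 !subSS !subn0.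
by lia.
Qed.
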